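(* Let $u$ be the solution with initial datum $u_0=1_{[0,1)}$, and let $(m_n)$, $(M_n)$ be the sequences defined recursively in the context, which converge (being monotone and bounded) to $$\lambda^-:=\lim_{n\to+\infty}m_n,\qquad \lambda^+:=\lim_{n\to+\infty}M_n .$$ Then $\lambda^+=\lambda^-=\sqrt2$, and $$\lim_{t\to+\infty}\|u(t,\cdot)-u_{\mathrm{stat}}(\cdot)\|_{L^\infty([0,+\infty))}=0,$$ where $u_{\mathrm{stat}}(x)=\max\{\sqrt2-x,0\}$ is the stationary solution with unit mass.
   Context: $1_A$ is the characteristic function of $A$. Solution. The problem is $u_t=u_x+1_{(0,u(t,0))}(x)$ for $t,x>0$, $u(0,\cdot)=u_0$. An integral solution with initial datum $u_0$ is a locally bounded function $w:\{(\tau,\xi):\tau>0,\ \xi>\tau\}\to[0,+\infty)$, defined everywhere, such that for any $\tau>0$ the limit $w(\tau,\tau):=\lim_{\xi\to\tau^+}w(\tau,\xi)$ exists in $[0,+\infty)$, and $w(\tau,\xi)=u_0(\xi)+\int_0^\tau 1_{(s,\,w(s,s)+s)}(\xi)\,ds$ for every $\tau>0$, $\xi>\tau$. For $u_0=1_{[0,1)}$ there is a unique integral solution $\hat u$, and $u(t,x):=\hat u(t,t+x)$. Definition of the sequences. Put $\alpha_n:=\frac1{n+1}$ for $n\ge0$. Put $T_0:=0$, $M_0:=0$, $t_0:=0$, $m_0:=1$. For $n\ge0$ set $$t^*_{n+1}:=t_n+m_n,\quad m^*_{n+1}:=m_n,\quad T^*_{n+1}:=T_n+M_n,\quad M^*_{n+1}:=M_n,\quad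 \Delta^*_n:=T^*_{n+1}-t^*_{n+1}.$$ If $\Delta^*_n\le0$: $$T_{n+1}:=T^*_{n+1}+\delta_n,\quad M_{n+1}:=M^*_{n+1}+2\delta_n,\quad t_{n+1}:=t^*_{n+1},\quad m_{n+1}:=m^*_{n+1},$$ where $\delta_0=1$ and $\delta_n=0$ for $n\ge1$. If $\Delta^*_n>0$: $$T_{n+1}:=t^*_{n+1},\quad M_{n+1}:=M^*_{n+1}-\Delta^*_n\alpha_n,\quad t_{n+1}:=T^*_{n+1},\quad m_{n+1}:=m^*_{n+1}+\Delta^*_n\alpha_{n+1}.$$ *)

(* Defs.v *)
From HB Require Import structures.
From mathcomp Require Import all_boot all_order all_algebra.
From mathcomp Require Import all_classical all_reals all_analysis.
Set Implicit Arguments.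
Unset Strict Implicit.
Unset Printing Implicit Defensive.
Import Order.TTheory GRing.Theory Num.Theory.
Import numFieldNormedType.Exports.
Local Open Scope classical_set_scope.
Local Open Scope ring_scope.

(* [w] is only meaningful on {(tau, xi) | 0 < tau <= xi}: the solution proper
   lives on tau < xi, and the diagonal value [w tau tau] stands for the
   right limit of [w tau] at [tau], as imposed by the third clause. Finiteness
   of that limit is implicit in [w tau tau : R], and its nonnegativity follows
   from the first clause. The integrability clause says that the integral in
   the last one is a genuine Lebesgue integral. *)
Definition is_integral_solution (R : realType) (u0 : R -> R)
    (w : R -> R -> R) : Prop :=
  [/\ forall tau xi : R, 0 < tau -> tau < xi -> 0 <= w tau xi,
      forall tau xi : R, 0 < tau -> tau < xi ->
        bounded_near (fun p : R * R => w p.1 p.2) (nbhs (tau, xi)),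
      forall tau : R, 0 < tau -> w tau xi @[xi --> tau^'+] --> w tau tau,
      forall tau xi : R, 0 < tau -> tau < xi ->
        (@lebesgue_measure R).-integrable `]0, tau[
          (fun s => (\1_(`]s, w s s + s[%classic) xi : R)%:E)
    & forall tau xi : R, 0 < tau -> tau < xi ->
        w tau xi = u0 xi +
          \int[@lebesgue_measure R]_(s in `]0, tau[)
            (\1_(`]s, w s s + s[%classic) xi : R)].

(* Passage from the integral solution along characteristics to
   the solution in the original variables. *)
Definition solution_of (R : realType) (w : R -> R -> R) (t x : R) : R :=
  w t (t + x).

Definition u_stat (R : realType) (x : R) : R := Num.max (Num.sqrt 2 - x) 0.

Definition is_stationary_solution (R : realType) (v : R -> R) : Prop :=
  exists2 w : R -> R -> R, is_integral_solution v w &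
    forall t x : R, 0 < t -> 0 <= x -> solution_of w t x = v x.

(* The norm of L^oo([0, +oo[), computed on the extension by zero. *)
Definition Linfty_half_line (R : realType) (f : R -> R) : \bar R :=
  ('N[@lebesgue_measure R]_+oo%E[EFin \o (f \_ `[0%R, +oo[)])%E.

Record extrema (R : realType) : Type := Extrema
  { max_time : R ; max_value : R ; min_time : R ; min_value : R }.

Definition alpha (R : realType) (n : nat) : R := n.+1%:R^-1.

Definition delta (R : realType) (n : nat) : R := (n == 0)%:R.

Definition next_extrema (R : realType) (n : nat) (e : extrema R) : extrema R :=
  let min_time' := min_time e + min_value e in
  let max_time' := max_time e + max_value e in
  let Delta := max_time' - min_time' in
  if Delta <= 0 then
    Extrema (max_time' + delta R n) (max_value e + 2 * delta R n)
            min_time' (min_value e)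
  else
    Extrema min_time' (max_value e - Delta * alpha R n)
            max_time' (min_value e + Delta * alpha R n.+1).

Fixpoint extrema_seq (R : realType) (n : nat) : extrema R :=
  if n is k.+1 then next_extrema k (extrema_seq R k) else Extrema 0 0 0 1.

(* (T_n, M_n) and (t_n, m_n) of the recursive definition are
   (max_time, max_value) and (min_time, min_value) of [extrema_seq R n]. *)
Definition M_seq (R : realType) (n : nat) : R := max_value (extrema_seq R n).

Definition m_seq (R : realType) (n : nat) : R := min_value (extrema_seq R n).

(* Main.v *)
Require Import Defs.
From mathcomp Require Import all_boot all_order all_algebra.
From mathcomp Require Import all_classical all_reals all_analysis.
From mathcomp Require Import measurable_realfun ess_sup_inf ring lra.
Set Implicit Arguments.
Unset Strict Implicit.
Unset Printing Implicit Defensive.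

Import Order.TTheory GRing.Theory Num.Theory.
Import numFieldNormedType.Exports.
Local Open Scope classical_set_scope.
Local Open Scope ring_scope.

(** Everything about a solution [w] is read off its boundary trace
    [v s := w s s], that is u(s, 0). The integral equation says that
    [w tau xi] is the initial datum at [xi] plus the length of the set of times
    [s < tau] with [s + v s > xi]; letting [xi] decrease to [tau] gives, for
    [tau >= 1], the delay equation

      v tau = length of { s < tau | s + v s > tau }.

    It forces [1 <= v <= 2], so only the times in the window ]tau - 2, tau[
    matter, and the last unit of time always counts. Two further facts decide
    the asymptotics.

    - The trace can only rise slowly ([trace_one_sided]). If v rises with slope
      at most 1/k on the window, then s + v s rises with slope at most
      (k + 1)/k, so while tau advances by d at least k d/(k + 1) of the old
      times stop counting, and v rises by at most d/(k + 1). After time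
      1 + 2 k the upward slope is therefore at most 1/(k + 1).

    - Mass is conserved ([integral_len_active]). Computing the area of
      { (s, xi) | 0 < s < T, s < xi < s + v s } by slices in s and by slices in
      xi shows that the profile at time [T] has integral 1.

    Let e = 2/(k + 1). On the two units of time after t the trace is at most
    v t + e, and on the two units before t it is at least v t - e. A trace that
    is constantly b produces a triangular profile of mass b^2/2, so comparing
    with mass 1 yields v t - e <= sqrt 2 <= v t + e ([trace_near_sqrt2]).
    The profile w t (t + x) is then uniformly within e of max (sqrt 2 - x) 0.

    The recursion for the extrema is settled by itself: for [n >= 1] it
    preserves t_n - T_n = (n + 1) m_n - n M_n >= 0 and M_n m_n = 2
    ([next_extrema_inv]). The first gives M_n - m_n <= m_n / n, hence both
    sequences have the same limit, and the second identifies it. *)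

(** * The recursion for the extrema *)

(** The first identity says that the trace rises with slope 1/(n + 1) from the
    minimum (t_n, m_n) to the next maximum. The product M m is twice the mass:
    when the previous minimum is (t_n - m, m), the profile at time t_n is
    generated by the single tooth (t_n - m, m), (T_n, M), (t_n, m), and it
    integrates to M m / 2. *)
Definition extrema_inv (R : realType) (n : nat) (e : extrema R) : Prop :=
  [/\ 0 <= min_time e - max_time e,
      min_time e - max_time e = n.+1%:R * min_value e - n%:R * max_value e,
      max_value e * min_value e = 2,
      0 < min_value e &
      min_value e <= max_value e].

(** Only the branch where the order of the extrema is exchanged has content; it
    rests on 1/(n + 1) - 1/(n + 2) = 1/((n + 1) (n + 2)). *)
Lemma next_extrema_inv (R : realType) (n : nat) (e : extrema R) :
  (0 < n)%N -> extrema_inv n e ->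
  extrema_inv n.+1 (next_extrema n e).
Proof.
case: e => T M t m n0; rewrite /extrema_inv /next_extrema /delta /alpha /=.
rewrite gtn_eqF //= => -[g0 gE Mm m0 mM].
have n1 : 1 <= n%:R :> R by rewrite ler1n.
have nS : n.+1%:R = n%:R + 1 :> R by rewrite natr1.
have nSS : n.+2%:R = n%:R + 1 + 1 :> R by rewrite !natr1.
move: n1 gE; rewrite nSS nS => n1 gE.
have [D0|D0] := leP (T + M - (t + m)) 0.
  by split; rewrite /=; lra.
set x := n%:R in n1 gE *.
have x1 : x + 1 != 0 by apply: lt0r_neq0; lra.
have x2 : x + 1 + 1 != 0 by apply: lt0r_neq0; lra.
set p := (x + 1)^-1; set q := (x + 1 + 1)^-1.
have px : p * (x + 1) = 1 by rewrite /p mulVf.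
have qx : q * (x + 1 + 1) = 1 by rewrite /q mulVf.
have p0 : 0 < p by rewrite /p invr_gt0; lra.
have q0 : 0 < q by rewrite /q invr_gt0; lra.
have pq : p + q <= 1 by nra.
set D := (T + M - (t + m)) in D0 *.
(* The gap identity turns the overshoot D into a combination of M and m, after
   which the corrections D p and D q of the recursion become explicit. *)
have DE : D = (x + 1) * M - (x + 2) * m by rewrite /D; lra.
have Dp : D * p = M - m - m * p.
  rewrite DE; transitivity (M * (p * (x + 1)) - m * (p * (x + 1)) - m * p); first by ring.
  by rewrite px !mulr1.
have Dq : D * q = M - m - M * q.
  rewrite DE; transitivity (M * (q * (x + 1 + 1)) - m * (q * (x + 1 + 1)) - M * q); first by ring.
  by rewrite qx !mulr1.
have Dp0 : 0 <= D * p by nra.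
have Dq0 : 0 <= D * q by nra.
split; rewrite /=.
- by rewrite /D in D0; lra.
- have -> : (x + 1 + 1) * (m + D * q) - (x + 1) * (M - D * p) =
     (x + 2) * m - (x + 1) * M + D * (q * (x + 1 + 1)) + D * (p * (x+1)) by ring.
  by rewrite px qx -/D; move: DE; rewrite /D; lra.
- have -> : (M - D * p) * (m + D * q) = M * m + (D * q * M - D * p * m) - D * p * (D * q) by ring.
  rewrite Mm.
  have pq_eq : p * q = p - q.
    have : p * q * ((x + 1 + 1) - (x + 1)) =
           p * (q * (x + 1 + 1)) - q * (p * (x + 1)) by ring.
    by rewrite px qx; lra.
  have -> : D * p * (D * q) = D * (D * p - D * q).
    by transitivity (D * D * (p * q)); [ring|rewrite pq_eq; ring].
  by rewrite [in X in _ - X]Dp [in X in _ - X]Dq; ring.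
- lra.
- have DM : D <= M - m by rewrite /D; lra.
  have : D * (p + q) <= D by nra.
  lra.
Qed.

Lemma extrema_seq_inv (R : realType) (n : nat) :
  extrema_inv n.+1 (extrema_seq R n.+1).
Proof.
elim: n => [|n IHn]; last exact: next_extrema_inv (ltn0Sn n) IHn.
rewrite /extrema_inv /= /next_extrema /delta /alpha /=.
rewrite ifT /=; last lra.
by split; lra.
Qed.

Lemma invn_cvg (R : realType) (c : R) : c / n.+1%:R @[n --> \oo] --> (0 : R).
Proof.
rewrite -[X in _ --> X](mulr0 c).
by apply: cvgM; [exact: cvg_cst|exact: cvg_harmonic].
Qed.

Lemma extrema_cvg (R : realType) :
  (M_seq R n @[n --> \oo] --> Num.sqrt (2 : R)) /\
  (m_seq R n @[n --> \oo] --> Num.sqrt (2 : R)).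
Proof.
have s0 : 0 <= Num.sqrt (2 : R) by exact: sqrtr_ge0.
have s2 : Num.sqrt (2 : R) * Num.sqrt 2 = 2.
  by rewrite -expr2 sqr_sqrtr.
set s := Num.sqrt 2 in s0 s2 *.
have bnd n : [/\ s <= M_seq R n.+1 <= s + 2 / n.+1%:R &
                 s - 2 / n.+1%:R <= m_seq R n.+1 <= s].
  rewrite /M_seq /m_seq.
  have [g0 gE Mm m0 mM] := extrema_seq_inv R n.
  set M := max_value _ in gE Mm mM *; set m := min_value _ in gE Mm m0 mM *.
  have Ms : s <= M by nra.
  have ms : m <= s by nra.
  have s_le2 : s <= 2 by nra.
  have n0 : 0 < n.+1%:R :> R by rewrite ltr0n.
  have nS : n.+2%:R = n.+1%:R + 1 :> R by rewrite !natr1.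
  have DE : M - m <= 2 / n.+1%:R.
    by rewrite ler_pdivlMr //; move: g0 gE; rewrite nS; lra.
  move: DE; set d := 2 / n.+1%:R => DE.
  have Md : M <= s + d by rewrite -lerBlDl (le_trans _ DE) // lerB.
  have md : s - d <= m by rewrite lerBlDr -lerBlDl (le_trans _ DE) // lerB.
  by rewrite Ms ms Md md.
split; rewrite -(cvg_shiftS (_ R)).
- apply: (@squeeze_cvgr _ _ _ _ (cst s) (fun n => s + 2 / n.+1%:R)).
  + by apply: nearW => n; have [] := bnd n.
  + exact: cvg_cst.
  + rewrite -[X in _ --> X]addr0; apply: cvgD; [exact: cvg_cst|exact: invn_cvg].
- apply: (@squeeze_cvgr _ _ _ _ (fun n => s - 2 / n.+1%:R) (cst s)).
  + by apply: nearW => n; have [] := bnd n.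
  + rewrite -[X in _ --> X]subr0; apply: cvgB; [exact: cvg_cst|exact: invn_cvg].
  + exact: cvg_cst.
Qed.

(** * Lengths, slices and triangles *)

Definition len (R : realType) (A : set R) : R := fine (@lebesgue_measure R A).

Lemma len_ge0 (R : realType) (A : set R) : 0 <= len A.
Proof. exact: fine_ge0. Qed.

Lemma mu_itvoo (R : realType) (a b : R) : a <= b ->
  @lebesgue_measure R `]a, b[ = (b - a)%:E.
Proof.
rewrite lebesgue_measure_itv /= lte_fin le_eqVlt => /predU1P[->|->] //.
by rewrite ltxx subrr.
Qed.

Lemma len_itvoo (R : realType) (a b : R) : a <= b ->
  len (`]a, b[%classic : set R) = b - a.
Proof. by move=> ab; rewrite /len mu_itvoo. Qed.

Lemma Rintegral_indic (R : realType) (D A : set R) :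
  measurable D -> measurable A ->
  \int[@lebesgue_measure R]_(s in D) (\1_A s : R) = len (A `&` D).
Proof. by move=> mD mA; rewrite /Rintegral integral_indic. Qed.

(** The mass of the profile max (b - x, 0) that a trace constantly equal to [b]
    sustains. The base point [a] lets the same formula serve at every time. *)
Lemma integral_triangle (R : realType) (a b : R) : 0 < b ->
  (\int[@lebesgue_measure R]_(x in `[a, +oo[) (Num.max (a + b - x) 0)%:E
   = (b ^+ 2 / 2)%:E)%E.
Proof.
move=> b0.
transitivity (\int[@lebesgue_measure R]_(x in `[a, (a + b)%R]) (a + b - x)%:E)%E.
  rewrite integral_mkcond [RHS]integral_mkcond; apply: eq_integral => x _.
  rewrite /patch !mem_setE !in_itv /= andbT.
  case: (leP a x) => //= ax; case: (leP x (a + b)) => xb /=.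
  - by rewrite max_l // subr_ge0.
  - by rewrite max_r // subr_le0 ltW.
pose F := (fun x : R => (a + b) * x - x ^+ 2 / 2).
have dF x : is_derive (x : R) 1 F (a + b - x).
  rewrite /F; apply: is_derive_eq; rewrite /GRing.scale /=; lra.
rewrite (@continuous_FTC2 _ _ F).
- by rewrite -EFinB; congr EFin; rewrite /F; lra.
- by lra.
- apply: continuous_subspaceT => x.
  by apply: cvgB; [exact: cvg_cst|exact: cvg_id].
- have cF : continuous F.
    by move=> x; apply/differentiable_continuous/derivable1_diffP; case: (dF x).
  split.
  + by move=> z _; case: (dF z).
  + exact/cvg_at_right_filter/cF.
  + exact/cvg_at_left_filter/cF.
- by move=> x _; rewrite derive1E; exact: derive_val.
Qed.

Lemma measurable_triangle (R : realType) (a : R) (D : set R) :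
  measurable_fun D (fun x => (Num.max (a - x) 0)%:E).
Proof.
apply/measurable_EFinP; apply: (@measurable_funS _ _ _ _ setT) => //.
by apply: measurable_maxr => //; exact: measurable_funB.
Qed.

Lemma Linfty_half_line_le (R : realType) (f : R -> R) (e : R) :
  (forall x, 0 <= x -> `|f x| <= e) -> 0 <= e ->
  (Linfty_half_line f <= e%:E)%E.
Proof.
move=> fe e0; rewrite /Linfty_half_line unlock /Lnorm.
case: ifP => // _; apply/ess_supP; apply: nearW => x /=.
rewrite /patch mem_setE in_itv /= andbT lee_fin.
by case: ifP => [/fe //|_]; rewrite normr0.
Qed.

Lemma cavalieri (R : realType) (A : set (R * R)) : measurable A ->
  (\int[@lebesgue_measure R]_x (@lebesgue_measure R) (xsection A x) =
   \int[@lebesgue_measure R]_y (@lebesgue_measure R) (ysection A y))%E.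
Proof.
move=> mA; have := indic_fubini_tonelli (@lebesgue_measure R) (@lebesgue_measure R) mA.
by rewrite indic_fubini_tonelli_FE // indic_fubini_tonelli_GE.
Qed.

(** * The stationary solution *)

(** The trace of this solution is constantly sqrt 2, so the source acts on the
    characteristic [xi] exactly during ]xi - sqrt 2, xi[, and the height gained
    there compensates the shift of the profile. *)
Lemma u_stat_stationary (R : realType) : is_stationary_solution (@u_stat R).
Proof.
set r : R := Num.sqrt 2.
have r0 : 0 < r by rewrite sqrtr_gt0.
pose w (t xi : R) : R := Num.max (r - (xi - t)) 0.
have wE s : w s s = r by rewrite /w subrr subr0 max_l // ltW.
have indE xi : (fun s : R => \1_(`]s, w s s + s[%classic) xi : R) =
    (\1_(`](xi - r), xi[%classic) : R -> R).
  apply/funext => s; rewrite !indicE !mem_setE !in_itv /= wE.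
  by congr (nat_of_bool _)%:R; rewrite andbC ltrBlDl.
exists w; last first.
  move=> t x t0 x0; rewrite /solution_of /w /u_stat -/r; congr Num.max; lra.
have cw : continuous (fun p : R * R => w p.1 p.2).
  move=> p; rewrite /w; apply: (@continuous_max _ _ (fun p => r - (p.2 - p.1)) (cst 0)).
  - apply: cvgB; first exact: cvg_cst.
    by apply: cvgB; [exact: cvg_snd|exact: cvg_fst].
  - exact: cvg_cst.
split.
- by move=> tau xi _ _; rewrite /w le_max lexx orbT.
- move=> tau xi _ _; apply: cvg_bounded; exact: (cw (tau, xi)).
- move=> tau _; apply: cvg_at_right_filter.
  apply: (@continuous_max _ _ (fun x => r - (x - tau)) (cst 0)).
  - apply: cvgB; first exact: cvg_cst.
    by apply: cvgB; [exact: cvg_id|exact: cvg_cst].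
  - exact: cvg_cst.
- move=> tau xi t0 txi.
  rewrite (_ : (fun s : R => _) = EFin \o (\1_(`](xi - r), xi[%classic) : R -> R)); last first.
    by rewrite -indE.
  by apply: (@integrableS _ _ _ _ setT) => //; exact: integrable_indic_itv.
- move=> tau xi t0 txi.
  rewrite indE Rintegral_indic //.
  pose c := Num.max (xi - r) 0.
  have -> : `](xi - r), xi[%classic `&` `]0%R, tau[%classic =
            (`]c, Num.max tau c[%classic : set R).
    apply/seteqP; split => s; rewrite /= !in_itv /=.
    + move=> [/andP[xs _] /andP[s0 st]].
      by rewrite gt_max lt_max xs s0 st.
    + move=> /andP[cs]; rewrite lt_max => /orP[st|sc]; last first.
        by have := lt_trans cs sc; rewrite ltxx.
      by move: cs; rewrite gt_max => /andP[-> ->]; rewrite st (lt_trans st txi).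
  have ctau : c <= Num.max tau c by rewrite le_max lexx orbT.
  rewrite len_itvoo // /w /u_stat -/r /c.
  case: (leP (xi - r) 0); case: (leP (r - (xi - tau)) 0); case: (leP (r - xi) 0);
    case: (leP tau 0); case: (leP tau (xi - r)); lra.
Qed.

Lemma integral_u_stat (R : realType) :
  (\int[@lebesgue_measure R]_(x in `[0%R, +oo[) (u_stat x)%:E = 1)%E.
Proof.
have s0 : 0 < Num.sqrt 2 :> R by rewrite sqrtr_gt0.
rewrite -[RHS](_ : (Num.sqrt 2 ^+ 2 / 2)%:E = 1%E); last by rewrite sqr_sqrtr // divff.
rewrite -(integral_triangle 0 s0); apply: eq_integral => x _.
by rewrite /u_stat add0r.
Qed.

(** * The boundary trace of an integral solution *)

(** The times before [tau] at which the source acts on the characteristic [xi].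
    The other condition, [s < xi], is automatic for [tau <= xi]. *)
Definition active (R : realType) (v : R -> R) (tau xi : R) : set R :=
  [set s | 0 < s < tau /\ xi < s + v s].

(** The closed form of the problem for the boundary values alone; the first term
    of [traceE] is the right limit of the initial datum at [tau]. *)
Record boundary_trace (R : realType) (v : R -> R) : Prop := BoundaryTrace {
  trace_measurable : forall tau xi, tau <= xi -> measurable (active v tau xi);
  traceE : forall tau, 0 < tau ->
    v tau = (tau < 1)%R%:R + len (active v tau tau) }.

Lemma active_sub (R : realType) (v : R -> R) (tau xi : R) :
  active v tau xi `<=` `]0, tau[.
Proof. by move=> s [+ _]; rewrite /= in_itv. Qed.

Lemma active_fin (R : realType) (v : R -> R) (tau xi : R) :
  measurable (active v tau xi) ->
  (@lebesgue_measure R (active v tau xi) < +oo)%E.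
Proof.
move=> mA; apply: (@le_lt_trans _ _ (@lebesgue_measure R `]0, tau[%classic)).
  by apply: le_measure; rewrite ?inE //; exact: active_sub.
by rewrite lebesgue_measure_itv /=; case: ifP => _; rewrite -?EFinB ltry.
Qed.

Lemma indic01 (R : realType) (x : R) : 0 < x ->
  (\1_(`[0, 1[%classic) x : R) = (x < 1)%R%:R.
Proof. by move=> x0; rewrite indicE mem_setE in_itv /= ltW. Qed.

Section integral_solution.
Context (R : realType) (w : R -> R -> R).
Hypothesis ws : is_integral_solution (\1_(`[0, 1[%classic) : R -> R) w.
Let v (s : R) := w s s.

Lemma indic_active (tau xi : R) : tau <= xi ->
  {in (`]0, tau[%classic : set R),
    (fun s => \1_(`]s, v s + s[%classic) xi) =1 (\1_(active v tau xi) : R -> R)}.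
Proof.
move=> txi s; rewrite mem_setE in_itv /= => /andP[s0 st].
rewrite !indicE mem_setE in_itv /= (lt_le_trans st txi) /= addrC.
congr (nat_of_bool _)%:R; apply/idP/idP; rewrite inE.
- by move=> ?; split; rewrite // s0.
- by case.
Qed.

Lemma measurable_active_lt (tau xi : R) : tau < xi ->
  measurable (active v tau xi).
Proof.
move=> txi; have [t0|t0] := leP tau 0.
  rewrite (_ : active _ _ _ = set0) //; apply/seteqP; split => // s.
  by move=> [/andP[s0 st] _]; have := lt_trans s0 (lt_le_trans st t0); rewrite ltxx.
case: ws => _ _ _ int_w _.
have /measurable_int /measurable_EFinP := int_w _ _ t0 txi.
move/(eq_measurable_fun _ (indic_active (ltW txi))) => mf.
have := mf (measurable_itv _) _ (measurable_set1 (1 : R)).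
congr measurable; apply/seteqP; split => s /=.
- move=> [_]; rewrite indicE; case: (boolP (s \in _)); first by rewrite inE.
  by move=> _ /eqP; rewrite eq_sym oner_eq0.
- by move=> sA; split; [exact: active_sub sA|rewrite indicE mem_set].
Qed.

(** Reduces measurability on the diagonal [xi = tau] to the case [tau < xi],
    where the integrability of the source term provides it. *)
Lemma bigcup_active_diag (tau : R) :
  active v tau tau = \bigcup_n active v (tau - n.+1%:R^-1) tau.
Proof.
apply/seteqP; split => s.
- move=> [/andP[s0 st] h]; have [k sk] := ltr_add_invr st.
  by exists k => //; split => //; rewrite s0 ltrBrDr.
- move=> [k _ [/andP[s0 sk] h]]; split => //; rewrite s0 (lt_trans sk) //.
  by rewrite ltrBlDr ltrDl invr_gt0 ltr0n.
Qed.

Lemma measurable_active (tau xi : R) : tau <= xi -> measurable (active v tau xi).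
Proof.
rewrite le_eqVlt => /predU1P[<-|]; last exact: measurable_active_lt.
rewrite bigcup_active_diag; apply: bigcupT_measurable => n.
by apply: measurable_active_lt; rewrite ltrBlDr ltrDl invr_gt0 ltr0n.
Qed.

Lemma solution_lenE (tau xi : R) : 0 < tau -> tau < xi ->
  w tau xi = (xi < 1)%R%:R + len (active v tau xi).
Proof.
move=> t0 txi; case: (ws) => _ _ _ _ -> //.
rewrite indic01 ?(lt_trans t0) //; congr (_ + _).
transitivity (\int[@lebesgue_measure R]_(s in `]0, tau[)
                (\1_(active v tau xi) s : R)).
  by apply: eq_Rintegral; exact: (indic_active (ltW txi)).
rewrite Rintegral_indic //.
  by rewrite setIidl //; exact: active_sub.
exact: measurable_active_lt.
Qed.

(** The sets grow to their limit as [xi] decreases to [tau], because their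
    defining inequality is strict: continuity of the measure from below. *)
Lemma len_active_right (tau : R) :
  len (active v tau (tau + n.+1%:R^-1)) @[n --> \oo] --> len (active v tau tau).
Proof.
apply: fine_cvg; rewrite fineK; last first.
  by rewrite ge0_fin_numE // active_fin //; exact: measurable_active.
have -> : active v tau tau = \bigcup_n active v tau (tau + n.+1%:R^-1).
  apply/seteqP; split => s.
  - by move=> [s0 h]; have [k sk] := ltr_add_invr h; exists k.
  - move=> [k _ [s0 sk]]; split; rewrite // (lt_trans _ sk) //.
    by rewrite ltrDl invr_gt0 ltr0n.
have mA n : measurable (active v tau (tau + n.+1%:R^-1)).
  by apply: measurable_active_lt; rewrite ltrDl invr_gt0 ltr0n.
apply: nondecreasing_cvg_mu => //; first exact: bigcupT_measurable.
move=> m n mn; apply/subsetPset => s [s0 h]; split; rewrite // (le_lt_trans _ h) //.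
by rewrite lerD2l lef_pV2 ?posrE ?ltr0n // ler_nat.
Qed.

Lemma solution_boundary_trace : boundary_trace v.
Proof.
split; first exact: measurable_active.
move=> tau t0; case: (ws) => _ _ lim_w _ _.
pose u n : R := tau + n.+1%:R^-1.
have tu n : tau < u n by rewrite /u ltrDl invr_gt0 ltr0n.
have utau : u n @[n --> \oo] --> tau.
  by rewrite -[X in _ --> X]addr0; apply: cvgD; [exact: cvg_cst|exact: cvg_harmonic].
have /cvg_at_rightP /(_ u (conj tu utau)) := lim_w _ t0.
move/(@cvg_unique _ (@Rhausdorff R)); apply.
rewrite [X in X @ _](_ : _ =
    fun n => (u n < 1)%R%:R + len (active v tau (u n))); last first.
  by apply/funext => n; exact: solution_lenE.
apply: cvgD; last exact: len_active_right.
apply: cvg_near_cst; have [t1|t1] := ltP tau 1.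
- near=> n; congr (nat_of_bool _)%:R; near: n.
  exact: (cvgr_lt _ utau).
- apply: nearW => n; congr (nat_of_bool _)%:R.
  by apply/negbTE; rewrite -leNgt (le_trans t1) // ltW.
Unshelve. all: by end_near. Qed.

End integral_solution.

(** * Bounds and slope of a boundary trace *)

Section trace.
Context (R : realType) (v : R -> R).
Hypothesis tr : boundary_trace v.
Local Notation mu := (@lebesgue_measure R).

Lemma mu_activeE (tau xi : R) : tau <= xi ->
  mu (active v tau xi) = (len (active v tau xi))%:E.
Proof.
move=> txi; rewrite /len fineK // ge0_fin_numE //.
by apply: active_fin; exact: (trace_measurable tr).
Qed.

Lemma len_active_ge (tau xi a b : R) : tau <= xi -> 0 <= a -> a <= b ->
  b <= tau -> (forall s, a < s -> s < b -> xi < s + v s) ->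
  b - a <= len (active v tau xi).
Proof.
move=> txi a0 ab bt H; rewrite -lee_fin -mu_activeE // -mu_itvoo //.
apply: le_measure; rewrite ?inE //; first exact: (trace_measurable tr).
move=> s; rewrite /= in_itv /= => /andP[as_ sb]; split; last exact: H.
by rewrite (le_lt_trans a0) // (lt_le_trans sb).
Qed.

Lemma len_active_le (tau xi a : R) : tau <= xi -> a <= tau ->
  (forall s, 0 < s -> s < tau -> xi < s + v s -> a < s) ->
  len (active v tau xi) <= tau - a.
Proof.
move=> txi at_ H; rewrite -lee_fin -mu_activeE // -mu_itvoo //.
apply: le_measure; rewrite ?inE //; first exact: (trace_measurable tr).
move=> s [/andP[s0 st] h]; rewrite /= in_itv /= st andbT; exact: H.
Qed.

Lemma trace_lenE (tau : R) : 1 <= tau -> v tau = len (active v tau tau).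
Proof.
move=> t1; rewrite (traceE tr) ?(lt_le_trans ltr01) //.
by rewrite ltNge t1 add0r.
Qed.

(** If v >= 1 before sg, a time t in [sg, sg + 1/2) sees the times of
    ]t - 1, sg[, whence v t > 1/2; then the times of [sg, t[ count as well, and
    the whole of ]t - 1, t[ does. *)
Lemma trace_ge1 (tau : R) : 0 < tau -> 1 <= v tau.
Proof.
move=> tau0.
suff H (k : nat) (t : R) : 0 < t -> t < 1 + k%:R / 2 -> 1 <= v t.
  apply: (H (Num.truncn (2 * tau)).+1) => //.
  have : 2 * tau < (Num.truncn (2 * tau)).+1%:R by exact: truncnS_gt.
  set n := _%:R; lra.
elim: k t => [|k IHk] t t0.
  rewrite mul0r addr0 => t1; rewrite (traceE tr t0) t1 lerDl; exact: len_ge0.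
pose sg : R := 1 + k%:R / 2.
have k0 : 0 <= k%:R :> R by rewrite ler0n.
have -> : 1 + k.+1%:R / 2 = sg + 1 / 2 :> R by rewrite /sg -natr1; lra.
have IH s : 0 < s -> s < sg -> 1 <= v s by exact: IHk.
have [tsg _|sgt tsg'] := ltP t sg; first exact: IH.
have sg1 : 1 <= sg by rewrite /sg; lra.
clear IHk k0; clearbody sg.
have half s : sg <= s -> s < sg + 1 / 2 -> 1 / 2 < v s.
  move=> sgs ssg; rewrite trace_lenE; last lra.
  have : sg - (s - 1) <= len (active v s s); last lra.
  apply: len_active_ge => //; try lra.
  move=> r sr rsg; have := IH r; lra.
rewrite trace_lenE; last lra.
have : t - (t - 1) <= len (active v t t); last lra.
apply: len_active_ge => //; try lra.
move=> r sr rt; have [rsg|sgr] := ltP r sg; first by have := IH r; lra.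
have := half r sgr; lra.
Qed.

(** A time more than 2 before [tau] has s + v s <= tau, hence does not count. *)
Lemma trace_le2 (tau : R) : 0 < tau -> v tau <= 2.
Proof.
move=> tau0.
suff H (k : nat) (t : R) : 0 < t -> t < 1 + k%:R -> v t <= 2.
  apply: (H (Num.truncn tau).+1) => //.
  have : tau < (Num.truncn tau).+1%:R by exact: truncnS_gt.
  set n := _%:R; lra.
elim: k t => [|k IHk] t t0.
  rewrite addr0 => t1; rewrite (traceE tr t0) t1.
  have : len (active v t t) <= t - 0 by apply: len_active_le => //; lra.
  by rewrite /=; lra.
rewrite -natr1 => tk.
have [t1|t1] := ltP t 1; first by apply: IHk => //; have := ler0n R k; lra.
rewrite trace_lenE //.
have [t2|t2] := leP t 2.
  have : len (active v t t) <= t - 0 by apply: len_active_le => //; lra.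
  lra.
have : len (active v t t) <= t - (t - 2); last lra.
apply: len_active_le => //; first lra.
move=> s s0 st h; rewrite ltNge; apply/negP => st2.
have := IHk s s0; lra.
Qed.

(** From [tau] to [tau'] at most tau' - tau new times start counting, while those
    with tau < s + v s <= tau' cease to. *)
Lemma trace_increment_le (tau tau' a l : R) : 1 <= tau -> tau <= tau' ->
  0 <= a -> 0 <= l -> a + l <= tau ->
  (forall s, a < s -> s < a + l -> tau < s + v s /\ s + v s <= tau') ->
  v tau' - v tau <= tau' - tau - l.
Proof.
move=> t1 tt' a0 l0 alt H.
rewrite !trace_lenE //; last exact: le_trans tt'.
have mA := trace_measurable tr (lexx tau).
have mA' := trace_measurable tr (lexx tau').
set A := active v tau tau in mA *; set A' := active v tau' tau' in mA' *.
have : (mu (A' `|` `]a, (a + l)%R[) <= mu (A `|` `[tau, tau'[))%E.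
  apply: le_measure; rewrite ?inE; [exact: measurableU|exact: measurableU|].
  move=> s [[/andP[s0 st] h]|].
  - have [stau|taus] := ltP s tau.
      by left; split; rewrite ?s0 // (le_lt_trans tt').
    by right; rewrite /= in_itv /= taus.
  - rewrite /= in_itv /= => /andP[as_ sal]; left; have [h _] := H s as_ sal.
    by split => //; rewrite (le_lt_trans a0) // (lt_le_trans sal).
rewrite measureU //; last first.
  apply/seteqP; split => // s [[_ h]]; rewrite /= in_itv /= => /andP[as_ sal].
  by have [_ h'] := H s as_ sal; have := lt_le_trans h h'; rewrite ltxx.
move/le_trans => /(_ _ (measureU2 mu mA (measurable_itv `[tau, tau'[))) /=.
have -> : mu A = (len A)%:E by exact: mu_activeE.
have -> : mu A' = (len A')%:E by exact: mu_activeE.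
rewrite mu_itvoo ?lerDl //.
have -> : mu `[tau, tau'[ = (tau' - tau)%:E.
  rewrite lebesgue_measure_itv /= lte_fin; move: tt'.
  by rewrite le_eqVlt => /predU1P[->|->] //; rewrite ltxx subrr.
by rewrite -!EFinD lee_fin; lra.
Qed.

(** Induction on [k]: an upward slope 1/(k + 1) of v is an upward slope
    (k + 2)/(k + 1) of s + v s, which therefore needs a time at least
    (tau' - tau) (k + 1)/(k + 2) to climb from [tau] to [tau']. During that time
    [trace_increment_le] applies. *)
Lemma trace_one_sided (k : nat) (tau tau' : R) : 1 + 2 * k%:R <= tau ->
  tau <= tau' -> tau' <= tau + 1 -> v tau' - v tau <= (tau' - tau) / k.+1%:R.
Proof.
elim: k tau tau' => [|k IHk] tau tau' ktau tt' tt1.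
  rewrite divr1; have : v tau' - v tau <= tau' - tau - 0; last lra.
  apply: (trace_increment_le (a := 0)) => //; try lra.
  by move=> s; lra.
have k0 := ler0n R k.
move: tt'; rewrite le_eqVlt => /predU1P[<-|tt']; first by rewrite !subrr mul0r.
have ktau2 : 1 + 2 * k%:R <= tau - 2 by move: ktau; rewrite -natr1; lra.
(* S gathers the times from tau - 2 on that do not count at tau. The climb starts
   at its supremum, after which s + v s stays above tau. *)
pose S := [set s | tau - 2 <= s /\ s + v s <= tau].
have S1 s : S s -> s <= tau - 1.
  by move=> [s1 s2]; have := @trace_ge1 s; lra.
have S2 : S (tau - 2) by split => //; have := @trace_le2 (tau - 2); lra.
have supS : has_sup S by split; [exists (tau - 2)|exists (tau - 1)].
have sup_ub s : S s -> s <= sup S by move=> Ss; apply: sup_upper_bound.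
have supS1 : sup S <= tau - 1 by apply: sup_le_ub => //; exists (tau - 2).
have supS2 : tau - 2 <= sup S by exact: sup_ub.
set p : R := k.+1%:R^-1; set q : R := k.+2%:R^-1.
have kp : (k%:R + 1) * p = 1 by rewrite natr1 divff.
have kq : (k%:R + 1 + 1) * q = 1 by rewrite !natr1 divff.
have p0 : 0 < p by rewrite invr_gt0 ltr0n.
have q0 : 0 < q by rewrite invr_gt0 ltr0n.
have q1 : q <= 1 by rewrite -kq; nra.
(* 1 - q = (k + 1)/(k + 2) is the inverse of the slope 1 + p of s + v s. *)
pose l := (tau' - tau) * (1 - q).
have l0 : 0 <= l by rewrite mulr_ge0; lra.
have l1 : l <= 1 by rewrite /l; nra.
have lE : (1 + p) * l = tau' - tau.
  rewrite /l; transitivity ((tau' - tau) * ((1 + p) * (1 - q))); first by ring.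
  have -> : (1 + p) * (1 - q) = 1.
    have : (p - q - p * q) * ((k%:R + 1) * (k%:R + 1 + 1)) =
       ((k%:R + 1) * p) * (k%:R + 1 + 1) - ((k%:R + 1 + 1) * q) * (k%:R + 1)
       - ((k%:R + 1) * p) * ((k%:R + 1 + 1) * q) by ring.
    rewrite kp kq => pq; have : p - q - p * q = 0; last lra.
    apply: (mulIf (_ : (k%:R + 1) * (k%:R + 1 + 1) != 0 :> R)); first nra.
    by rewrite pq; lra.
  by rewrite mulr1.
have -> : (tau' - tau) * q = tau' - tau - l by rewrite /l; lra.
apply: (trace_increment_le (a := sup S)) => //; try lra.
move=> s s1 s2; split.
  rewrite ltNge; apply/negP => h.
  have : S s by split => //; lra.
  by move/sup_ub; lra.
(* Since sup S need not belong to S, the climb is measured from a point sg of S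
   close enough to it, at distance less than l from s. *)
have [|sg [Ssg1 Ssg2] sgl] := @sup_adherent _ S (sup S + l - s) _ supS; first lra.
have sgs : sg <= sup S by exact: sup_ub.
have := IHk sg s; rewrite -/p => IH.
have : v s - v sg <= (s - sg) * p by apply: IH; lra.
nra.
Qed.

End trace.

(** * Conservation of mass *)

Section mass.
Context (R : realType) (v : R -> R).
Hypothesis tr : boundary_trace v.
Local Notation mu := (@lebesgue_measure R).

Definition hypograph (T : R) : set (R * R) :=
  [set p | 0 < p.1 < T /\ p.1 < p.2 < p.1 + v p.1].

(** Both inequalities s < xi and xi < s + v s are separated by rationals, which
    exhibits the set as built from countably many measurable rectangles. *)
Lemma measurable_hypograph (T : R) : measurable (hypograph T).
Proof.
have -> : hypograph T = (\bigcup_(q : rat) (`]-oo, ratr q[ `*` `]ratr q, +oo[)) `&`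
   (\bigcup_(q : rat) (active v (Num.min T (ratr q)) (ratr q) `*` `]-oo, ratr q[)).
  apply/seteqP; split => -[s xi] /=.
  - move=> [/= /andP[s0 sT] /andP[sx xh]]; split.
      have [q] := rat_in_itvoo sx; rewrite in_itv /= => /andP[sq qx].
      by exists q => //; split; rewrite /= in_itv /= ?sq ?qx.
    have [q] := rat_in_itvoo xh; rewrite in_itv /= => /andP[xq qh].
    exists q => //; split; rewrite /= ?in_itv //=; split => //.
    by rewrite s0 lt_min sT (lt_trans sx).
  - move=> [[q _ []] /=]; rewrite !in_itv /= andbT => sq qx.
    move=> [q' _ [/= []]]; rewrite in_itv /= lt_min => /andP[s0 /andP[sT _]] h xq.
    by split; rewrite /= ?s0 ?sT ?(lt_trans sq) // (lt_trans xq).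
apply: measurableI; apply: bigcupT_measurable_rat => q; apply: measurableX => //.
by apply: (trace_measurable tr); rewrite ge_min lexx orbT.
Qed.

Lemma xsection_hypograph (T s : R) :
  xsection (hypograph T) s = if 0 < s < T then `]s, s + v s[%classic else set0.
Proof.
apply/seteqP; split => xi; rewrite /xsection /= inE.
- by move=> [/= -> h]; rewrite /= in_itv.
- by case: ifP => // sT; rewrite /= in_itv /= => h; split.
Qed.

Lemma ysection_hypograph (T xi : R) :
  ysection (hypograph T) xi = active v (Num.min T xi) xi.
Proof.
apply/seteqP; split => s; rewrite /ysection /= inE.
- by move=> [/= /andP[s0 sT] /andP[sx h]]; split; rewrite // s0 lt_min sT.
- move=> [+ h]; rewrite lt_min => /andP[s0 /andP[sT sx]].
  by split; rewrite /= ?s0 ?sT ?sx.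
Qed.

Lemma measurable_mu_active_min (T : R) :
  measurable_fun setT (fun xi => mu (active v (Num.min T xi) xi)).
Proof.
rewrite (_ : (fun xi => _) = mu \o ysection (hypograph T)); last first.
  by apply/funext => xi; rewrite /= ysection_hypograph.
by apply: measurable_fun_ysection; exact: measurable_hypograph.
Qed.

(** Conservation of mass. Slicing the hypograph at fixed s gives the integral of
    v over ]0, T[. At fixed xi < T it gives v xi less the initial datum, and at
    fixed xi >= T the profile at time T; the integral of v cancels, leaving
    the mass of the datum. *)
Lemma integral_len_active (T : R) : 1 <= T ->
  (\int[mu]_(xi in `[T, +oo[) mu (active v T xi) = 1)%E.
Proof.
move=> T1.
pose f xi := mu (active v (Num.min T xi) xi).
have f0 xi : (0 <= f xi)%E by exact: measure_ge0.
have mf D : measurable_fun D f.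
  by apply: (@measurable_funS _ _ _ _ setT) => //; exact: measurable_mu_active_min.
have := cavalieri (measurable_hypograph T).
under eq_integral do rewrite xsection_hypograph.
under [RHS]eq_integral do rewrite ysection_hypograph -/(f _).
have -> : (\int[mu]_s mu (if (0 < s < T)%R then `]s, (s + v s)%R[%classic else set0) =
   \int[mu]_(s in `]0%R, T[) ((\1_(`]0, 1[%classic) s)%:E + f s))%E.
  rewrite [RHS]integral_mkcond; apply: eq_integral => s _.
  rewrite /patch mem_setE in_itv /=; case: ifP => [/andP[s0 sT]|_]; last exact: measure0.
  rewrite (mu_itvoo (_ : s <= s + v s)) //; last first.
    by rewrite lerDl (le_trans ler01) // (trace_ge1 tr).
  rewrite addrC addKr (traceE tr) // indicE mem_setE in_itv /= s0 /=.
  by rewrite /f min_r ?(ltW sT) // (mu_activeE tr).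
have -> : (\int[mu]_x f x = \int[mu]_(x in `]0%R, +oo[) f x)%E.
  rewrite [RHS]integral_mkcond; apply: eq_integral => x _.
  rewrite /patch mem_setE in_itv /= andbT; case: ltP => // x0.
  rewrite /f (_ : active _ _ _ = set0) ?measure0 //.
  apply/seteqP; split => // s [+ _]; rewrite lt_min => /andP[s0 /andP[_ sx]].
  by have := lt_trans s0 (lt_le_trans sx x0); rewrite ltxx.
have -> : `]0%R, +oo[%classic = `]0%R, T[ `|` `[T, +oo[ :> set R.
  apply/seteqP; split => x /=; rewrite !in_itv /= !andbT.
  - by move=> ->; case: (ltP x T); [left|right].
  - by move=> [/andP[]//|Tx]; rewrite (lt_le_trans _ Tx) // (lt_le_trans ltr01).
have disj : [disjoint (`]0%R, T[%classic : set R) & (`[T, +oo[%classic : set R)].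
  apply/disj_setPS => x [] /=; rewrite !in_itv /= andbT => /andP[_ xT] Tx.
  by have := lt_le_trans xT Tx; rewrite ltxx.
rewrite ge0_integral_setU //; last exact: mf.
rewrite ge0_integralD //; last 2 first.
- by apply/measurable_EFinP; exact: measurable_indic.
- exact: mf.
rewrite integral_indic // (_ : `]0, 1[ `&` `]0, T[ = `]0, 1[%classic); last first.
  apply/setIidPl => x; rewrite /= !in_itv /= => /andP[-> x1].
  exact: lt_le_trans T1.
have mu01 : mu `]0, 1[ = 1%E by rewrite (mu_itvoo ler01) subr0.
rewrite [X in (X + _)%E = _ -> _](_ : _ = 1%E); last exact: mu01.
have X_fin : (\int[mu]_(x in `]0%R, T[) f x \is a fin_num)%E.
  rewrite ge0_fin_numE ?integral_ge0 //.
  apply: (@le_lt_trans _ _ (\int[mu]_(x in `]0%R, T[) (cst 2%:E) x)%E).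
    apply: ge0_le_integral => //.
    - exact: mf.
    - move=> x; rewrite /= in_itv /= => /andP[x0 xT].
      rewrite /f min_r ?(ltW xT) // (mu_activeE tr) // lee_fin.
      have := trace_le2 tr x0; rewrite (traceE tr x0).
      by have := ler0n R (x < 1)%R; lra.
  rewrite integral_cst // [X in (_ * X)%E](_ : _ = (T - 0)%:E).
    by rewrite -EFinM ltry.
  by apply: mu_itvoo; exact: le_trans T1.
have -> : (\int[mu]_(xi in `[T, +oo[) mu (active v T xi) =
           \int[mu]_(xi in `[T, +oo[) f xi)%E.
  apply: eq_integral => x; rewrite mem_setE in_itv /= andbT => Tx.
  by rewrite /f min_l.
set X := (\int[mu]_(x in `]0%R, T[) f x)%E in X_fin *.
by move=> fubini; rewrite -[LHS](addeK _ X_fin) (addeC _ X) -fubini addeK.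
Qed.

(** Only the window ]T - 2, T[ is constrained: earlier times do not count,
    since v <= 2. *)
Lemma len_active_ub (T xi b : R) : 2 <= T -> T <= xi ->
  (forall s, T - 2 < s -> s < T -> v s <= b) ->
  len (active v T xi) <= Num.max (T + b - xi) 0.
Proof.
move=> T2 Txi H.
have -> : Num.max (T + b - xi) 0 = T - Num.min T (xi - b).
  by case: (leP T (xi - b)); case: (leP (T + b - xi) 0); lra.
apply: (len_active_le tr) => //; first by rewrite ge_min lexx.
move=> s s0 sT h.
have [s2|s2] := leP s (T - 2); first by have := trace_le2 tr s0; lra.
by rewrite gt_min; apply/orP; right; have := H s s2 sT; lra.
Qed.

Lemma len_active_lb (T xi b : R) : 2 <= T -> T <= xi -> b <= 2 ->
  (forall s, T - 2 < s -> s < T -> b <= v s) ->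
  Num.max (T + b - xi) 0 <= len (active v T xi).
Proof.
move=> T2 Txi b2 H; rewrite ge_max len_ge0 andbT.
have [Tb|Tb] := leP (T + b - xi) 0; first exact: le_trans (len_ge0 _).
have : T - (xi - b) <= len (active v T xi); last lra.
apply: (len_active_ge tr) => //; try lra.
by move=> s s1 s2; have := H s; lra.
Qed.

Lemma measurable_len_active (T : R) :
  measurable_fun `[T, +oo[ (fun xi => mu (active v T xi)).
Proof.
apply: (@eq_measurable_fun _ _ _ _ _ (fun xi => mu (active v (Num.min T xi) xi))).
  by move=> x; rewrite mem_setE in_itv /= andbT => Tx; rewrite min_l.
by apply: (@measurable_funS _ _ _ _ setT) => //; exact: measurable_mu_active_min.
Qed.

(** A trace at most b on the window generates at most the triangle of mass
    b^2/2, which must hold the unit mass. *)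
Lemma trace_window_ub (T b : R) : 2 <= T -> 0 < b ->
  (forall s, T - 2 < s -> s < T -> v s <= b) -> Num.sqrt 2 <= b.
Proof.
move=> T2 b0 H.
have : (1%:E <= (b ^+ 2 / 2)%:E :> \bar R)%E.
  rewrite -(integral_triangle T b0) -(@integral_len_active T); last lra.
  apply: ge0_le_integral => //.
  - exact: measurable_len_active.
  - exact: measurable_triangle.
  - move=> x; rewrite /= in_itv /= andbT => Tx.
    by rewrite (mu_activeE tr) // lee_fin; exact: len_active_ub.
rewrite lee_fin => h; have s0 : 0 <= Num.sqrt 2 :> R by exact: sqrtr_ge0.
have s2 : Num.sqrt 2 * Num.sqrt 2 = 2 :> R by rewrite -expr2 sqr_sqrtr.
rewrite expr2 in h; nra.
Qed.

Lemma trace_window_lb (T b : R) : 2 <= T -> 0 < b -> b <= 2 ->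
  (forall s, T - 2 < s -> s < T -> b <= v s) -> b <= Num.sqrt 2.
Proof.
move=> T2 b0 b2 H.
have : ((b ^+ 2 / 2)%:E <= 1%:E :> \bar R)%E.
  rewrite -(integral_triangle T b0) -(@integral_len_active T); last lra.
  apply: ge0_le_integral => //.
  - by move=> x _; rewrite lee_fin le_max lexx orbT.
  - exact: measurable_triangle.
  - exact: measurable_len_active.
  - move=> x; rewrite /= in_itv /= andbT => Tx.
    by rewrite (mu_activeE tr) // lee_fin; exact: len_active_lb.
rewrite lee_fin => h; have s0 : 0 <= Num.sqrt 2 :> R by exact: sqrtr_ge0.
have s2 : Num.sqrt 2 * Num.sqrt 2 = 2 :> R by rewrite -expr2 sqr_sqrtr.
rewrite expr2 in h; nra.
Qed.

(** Because v hardly rises, its value at [t] almost bounds it from above on the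
    window that follows, and from below on the window that precedes; each
    window confronts this bound with the unit mass. *)
Lemma trace_near_sqrt2 (k : nat) (t : R) : 3 + 2 * k%:R <= t ->
  `|v t - Num.sqrt 2| <= 2 / k.+1%:R.
Proof.
move=> kt; have k0 := ler0n R k.
set e := 2 / k.+1%:R.
have e0 : 0 < e by rewrite divr_gt0 ?ltr0n.
have s0 : 0 <= Num.sqrt 2 :> R by exact: sqrtr_ge0.
have v1 : 1 <= v t by apply: (trace_ge1 tr); lra.
have v2 : v t <= 2 by apply: (trace_le2 tr); lra.
(* The slope estimate covers one unit of time, and a window lasts two: it is
   applied on both halves of [s, s']. *)
have slope s s' : 1 + 2 * k%:R <= s -> s <= s' -> s' <= s + 2 ->
    v s' <= v s + e.
  move=> ks ss' s's.
  have := trace_one_sided tr (tau := s) (tau' := (s + s') / 2) ks.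
  have := trace_one_sided tr (k := k) (tau := (s + s') / 2) (tau' := s').
  rewrite /e; set p := k.+1%:R^-1.
  have p0 : 0 < p by rewrite invr_gt0 ltr0n.
  move=> h1 h2.
  have {}h1 : v s' - v ((s + s') / 2) <= (s' - (s + s') / 2) * p by apply: h1; lra.
  have {}h2 : v ((s + s') / 2) - v s <= ((s + s') / 2 - s) * p by apply: h2; lra.
  nra.
have ub : Num.sqrt 2 <= v t + e.
  apply: (@trace_window_ub (t + 2)); try lra.
  by move=> s s1 s2; apply: slope; lra.
have lb : v t - e <= Num.sqrt 2.
  have [|d0] := leP (v t - e) 0; first lra.
  apply: (@trace_window_lb t); try lra.
  by move=> s s1 s2; rewrite lerBlDr; apply: slope; lra.
by rewrite ler_norml; apply/andP; split; lra.
Qed.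

End mass.

(** * Convergence *)

Lemma solution_near_stat (R : realType) (w : R -> R -> R) (k : nat) (t x : R) :
  is_integral_solution (\1_(`[0, 1[%classic) : R -> R) w ->
  5 + 2 * k%:R <= t -> 0 <= x ->
  `|solution_of w t x - u_stat x| <= 2 / k.+1%:R.
Proof.
move=> ws kt x0; have k0 := ler0n R k.
have tr := solution_boundary_trace ws; set v := fun s => w s s in tr.
have wE : solution_of w t x = len (active v t (t + x)).
  rewrite /solution_of; move: x0; rewrite le_eqVlt => /predU1P[<-|x0].
    by rewrite addr0 -(trace_lenE tr) //; lra.
  rewrite (solution_lenE ws) ?ltrDl //; last lra.
  by rewrite (_ : t + x < 1 = false) ?add0r //; apply/negbTE; rewrite -leNgt; lra.
set e := 2 / k.+1%:R.
have e0 : 0 < e by rewrite divr_gt0 ?ltr0n.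
have H s : t - 2 < s -> s < t -> `|v s - Num.sqrt 2| <= e.
  by move=> s1 s2; apply: (trace_near_sqrt2 tr); lra.
have s0 : 0 <= Num.sqrt 2 :> R by exact: sqrtr_ge0.
have s2 : Num.sqrt 2 * Num.sqrt 2 = 2 :> R by rewrite -expr2 sqr_sqrtr.
have ub : len (active v t (t + x)) <= Num.max (t + (Num.sqrt 2 + e) - (t + x)) 0.
  apply: (len_active_ub tr); try lra.
  by move=> s s1 s3; have := H s s1 s3; rewrite ler_norml => /andP[]; lra.
have lb : Num.max (t + (Num.sqrt 2 - e) - (t + x)) 0 <= len (active v t (t + x)).
  apply: (len_active_lb tr); try lra; first nra.
  by move=> s s1 s3; have := H s s1 s3; rewrite ler_norml => /andP[]; lra.
rewrite wE /u_stat ler_norml; move: ub lb.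
case: (leP (t + (Num.sqrt 2 + e) - (t + x)) 0); case: (leP (t + (Num.sqrt 2 - e) - (t + x)) 0);
case: (leP (Num.sqrt 2 - x) 0) => *; apply/andP; split; lra.
Qed.

Theorem proposition8p3 (R : realType) :
  [/\ cvgn (M_seq R) /\ cvgn (m_seq R),
      limn (M_seq R) = Num.sqrt 2 /\ limn (m_seq R) = Num.sqrt 2,
      is_stationary_solution (@u_stat R) /\
        (\int[@lebesgue_measure R]_(x in `[0%R, +oo[) (u_stat x)%:E = 1)%E
    & forall w : R -> R -> R,
        is_integral_solution (\1_(`[0, 1[%classic) : R -> R) w ->
        Linfty_half_line (fun x => solution_of w t x - u_stat x)
          @[t --> +oo%R] --> 0%E].
Proof.
have [cM cm] := extrema_cvg R.
split.
- by split; [apply: cvgP cM|apply: cvgP cm].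
- by split; apply/cvg_lim.
- by split; [exact: u_stat_stationary|exact: integral_u_stat].
move=> w ws.
set N := fun t => Linfty_half_line (fun x => solution_of w t x - u_stat x).
have N0 t : (0 <= N t)%E by exact: Lnorm_ge0.
have N_le k : \forall t \near +oo, (N t <= (2 / k.+1%:R)%:E)%E.
  near=> t; apply: Linfty_half_line_le => [x x0|]; last by rewrite divr_ge0.
  by apply: solution_near_stat => //; near: t; apply: nbhs_pinfty_ge; rewrite num_real.
apply/fine_cvgP; split.
  near=> t; rewrite ge0_fin_numE //; apply: (@le_lt_trans _ _ (2 / 1%:R)%:E); last exact: ltry.
  by near: t; exact: (N_le 0).
apply/cvgrPdist_le => e e0.
have [k] : exists k, 0 + k.+1%:R^-1 < e / 2 by apply: ltr_add_invr; rewrite divr_gt0.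
rewrite add0r => ke; near=> t.
have Nt : (N t <= e%:E)%E.
  apply: (@le_trans _ _ (2 / k.+1%:R)%:E); first by near: t; exact: N_le.
  by rewrite lee_fin mulrC -ler_pdivlMr // ltW.
rewrite sub0r normrN /= ger0_norm ?fine_ge0 // -lee_fin fineK //.
by rewrite ge0_fin_numE // (le_lt_trans Nt) // ltry.
Unshelve. all: by end_near. Qed.
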